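(* Let $\mathcal N$ be a finite, locally irreducible, strongly connected and critical abelian network with period vector $\mathbf r$. Let $\mathbf x.\mathbf q$ be a configuration of $\mathcal N$, and let $w\in A^*$ be any $\mathbf r$-maximal legal execution for $\mathbf x.\mathbf q$. Then $\mathbf x.\mathbf q$ is recurrent if and only if $|w|=\mathbf r$ and $t_w\mathbf q=\mathbf q$.
   Context: Abelian networks. $\mathbb N=\{0,1,2,\dots\}$. Let $G=(V,E)$ be a finite directed graph (self-loops and multiple edges allowed). An abelian network $\mathcal N$ on $G$ assigns to each $v\in V$ a nonempty input alphabet $A_v$ and a nonempty state space $Q_v$ (the $A_v$ pairwise disjoint), maps $T_a:Q_v\to Q_v$ for $a\in A_v$, and, for each edge $e$ from $v$ to $u$, a message-passing function $T_e:Q_v\times A_v\to A_u^*$ (free monoid of words), such that for all $v$, $a,b\in A_v$, $q\in Q_v$: $T_aT_b=T_bT_a$, and for every edge $e$ out of $v$ the words $T_e(q,a)T_e(T_a(q),b)$ and $T_e(q,b)T_e(T_b(q),a)$ agree up to permuting letters. Put $A=\bigsqcup_v A_v$, $Q=\prod_v Q_v$; $\mathcal N$ is finite if $A$ and $Q$ are finite. For a word $w\in A^*$, $|w|\in\mathbb N^A$ counts the occurrences of each letter. For $a\in A_v$, $\mathbf q\in Q$: $t_a\mathbf q$ is $\mathbf q$ with $\mathbf q(v)$ replaced by $T_a(\mathbf q(v))$, and $\mathbf M_a(\mathbf q)=\sum_{e\text{ out of }v}|T_e(\mathbf q(v),a)|\in\mathbb N^A$. A configuration is a pair $\mathbf x.\mathbf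 q$ with $\mathbf x\in\mathbb Z^A$, $\mathbf q\in Q$; $\pi_a(\mathbf x.\mathbf q)=(\mathbf x+\mathbf M_a(\mathbf q)-|a|).t_a\mathbf q$. For $w=a_1\cdots a_\ell$: $t_w=t_{a_\ell}\cdots t_{a_1}$, $\mathbf M_w(\mathbf q)=\sum_i\mathbf M_{a_i}(t_{a_1\cdots a_{i-1}}\mathbf q)$, $\pi_w=\pi_{a_\ell}\cdots\pi_{a_1}$; these depend only on $|w|$, so $t_{\mathbf n},\mathbf M_{\mathbf n},\pi_{\mathbf n}$ are defined for $\mathbf n\in\mathbb N^A$. The word $w$ is legal for $\mathbf x.\mathbf q$ (a legal execution) if, with $\mathbf x_i.\mathbf q_i=\pi_{a_1\cdots a_i}(\mathbf x.\mathbf q)$, $\mathbf x_{i-1}(a_i)\ge1$ for all $1\le i\le\ell$. Write $\mathbf x.\mathbf q\to\mathbf x'.\mathbf q'$ if $\pi_w(\mathbf x.\mathbf q)=\mathbf x'.\mathbf q'$ for some (possibly empty) word $w$ legal for $\mathbf x.\mathbf q$. Vector inequalities are coordinatewise. Local recurrence, kernel, production matrix. $\mathcal N$ is locally irreducible if for all $\mathbf q,\mathbf q'\in Q$ there are words $w,w'$ with $t_w\mathbf q=t_{w'}\mathbf q'$. For $\mathcal N$ finite, let $e$ be the product of all idempotents of the finite commutative monoid generated by the $t_a$ in $\mathrm{End}(Q)$; $\mathrm{Loc}(\mathcal N)=eQ$ is the set of locally recurrent states. The total kernel is $K=\{\mathbf z\in\mathbb Z^A: t_{\mathbf z^+}\mathbf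 q=t_{\mathbf z^-}\mathbf q\ \forall\mathbf q\in\mathrm{Loc}(\mathcal N)\}$, with $\mathbf z^{\pm}\in\mathbb N^A$ the positive/negative parts of $\mathbf z$; it is a finite-index subgroup of $\mathbb Z^A$. For $\mathcal N$ finite and locally irreducible, the production matrix $P$ is the unique rational $A\times A$ matrix with $P\mathbf k=\mathbf M_{\mathbf k}(\mathbf q)$ for all $\mathbf k\in K\cap\mathbb N^A$ and $\mathbf q\in\mathrm{Loc}(\mathcal N)$. $\mathcal N$ is critical if the spectral radius of $P$ is $1$, and strongly connected if the digraph on $A$ with an edge $(a,b)$ whenever $P_{ba}>0$ is strongly connected. Period vector and recurrence. For critical strongly connected $\mathcal N$, the period vector $\mathbf r$ is the unique positive integer vector generating the group $\{\mathbf k\in K:P\mathbf k=\mathbf k\}$. Two configurations are legally related if there is a configuration $\mathbf x_3.\mathbf q_3$ with $\mathbf x_1.\mathbf q_1\to\mathbf x_3.\mathbf q_3$ and $\mathbf x_2.\mathbf q_2\to\mathbf x_3.\mathbf q_3$. A configuration $\mathbf x.\mathbf q$ is recurrent if there is a nonempty legal execution for $\mathbf x.\mathbf q$, and every configuration $\mathbf x'.\mathbf q'$ legally related to $\mathbf x.\mathbf q$ satisfies $\mathbf x'.\mathbf q'\to\mathbf x.\mathbf q$. A legal execution $w$ for $\mathbf x.\mathbf q$ is $\mathbf r$-maximal if $|w|\le\mathbf r$ and, for all $a\in A$, either $|w|(a)=\mathbf r(a)$ or $wa$ is not a legal execution for $\mathbf x.\mathbf q$. *)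

(* Defs.v *)
From HB Require Import structures.
From mathcomp Require Import all_boot all_order all_algebra all_field.
Set Implicit Arguments.
Unset Strict Implicit.
Unset Printing Implicit Defensive.
Import Order.TTheory GRing.Theory Num.Theory.
Local Open Scope ring_scope.

(* A finite directed multigraph is given by a finite type [V] of vertices and,
   for each pair [v], [u], a finite type [E v u] of edges from [v] to [u].
   The alphabets and state spaces are finite types, so these are exactly the
   finite abelian networks on the graph. *)
Record abelian_network (V : finType) (E : V -> V -> finType) := AbelianNetwork {
  alphabet : V -> finType;
  state_space : V -> finType;
  alphabet_gt0 : forall v, (0 < #|alphabet v|)%N;
  state_space_gt0 : forall v, (0 < #|state_space v|)%N;
  transition : forall v, alphabet v -> state_space v -> state_space v;
  message : forall v u, E v u ->
    state_space v -> alphabet v -> seq (alphabet u);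
  transitionC : forall v (a b : alphabet v) q,
    transition a (transition b q) = transition b (transition a q);
  messageC : forall v u (e : E v u) (a b : alphabet v) q,
    perm_eq (message e q a ++ message e (transition a q) b)
            (message e q b ++ message e (transition b q) a)
}.

Definition letter V E (N : @abelian_network V E) : finType :=
  {v : V & alphabet N v}.

Definition state V E (N : @abelian_network V E) : finType :=
  {dffun forall v, state_space N v}.

Definition natvec V E (N : @abelian_network V E) := {ffun letter N -> nat}.
Definition intvec V E (N : @abelian_network V E) := {ffun letter N -> int}.
Definition config V E (N : @abelian_network V E) := (intvec N * state N)%type.

Definition intvec_of V E (N : @abelian_network V E) (n : natvec N) : intvec N :=
  [ffun a => (n a)%:Z].

Definition wcount V E (N : @abelian_network V E) (w : seq (letter N)) :
    natvec N :=
  [ffun a => count_mem a w].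

Definition act V E (N : @abelian_network V E) (q : state N) (a : letter N) :
    state N :=
  [ffun v => dfwith q (transition (tagged a) (q (tag a))) v].

Definition act_word V E (N : @abelian_network V E) (q : state N)
    (w : seq (letter N)) : state N :=
  foldl (@act V E N) q w.

Definition produce V E (N : @abelian_network V E) (q : state N)
    (a : letter N) : natvec N :=
  [ffun b => \sum_(u : V) \sum_(e : E (tag a) u)
     wcount [seq (Tagged (alphabet N) c : letter N)
            | c <- message e (q (tag a)) (tagged a)] b]%N.

Fixpoint produce_word V E (N : @abelian_network V E) (q : state N)
    (w : seq (letter N)) : natvec N :=
  if w is a :: w' then
    [ffun b => produce q a b + produce_word (act q a) w' b]%N
  else [ffun => 0%N].

Definition fire V E (N : @abelian_network V E) (c : config N) (a : letter N) :
    config N :=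
  ([ffun b => c.1 b + (produce c.2 a b)%:Z - (b == a)%:Z], act c.2 a).

Definition fire_word V E (N : @abelian_network V E) (c : config N)
    (w : seq (letter N)) : config N :=
  foldl (@fire V E N) c w.

Fixpoint legal V E (N : @abelian_network V E) (c : config N)
    (w : seq (letter N)) : bool :=
  if w is a :: w' then (1 <= c.1 a) && legal (fire c a) w' else true.

Definition reaches V E (N : @abelian_network V E) (c c' : config N) : Prop :=
  exists2 w, legal c w & fire_word c w = c'.

(* A chosen word with letter counts [n]; [act_word_perm] and
   [produce_word_perm] show that the choice is immaterial in [act_vec] and
   [produce_vec]. *)
Definition word_of V E (N : @abelian_network V E) (n : natvec N) :
    seq (letter N) :=
  flatten [seq nseq (n a) a | a <- enum (letter N)].

Definition act_vec V E (N : @abelian_network V E) (q : state N)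
    (n : natvec N) : state N :=
  act_word q (word_of n).

Definition produce_vec V E (N : @abelian_network V E) (q : state N)
    (n : natvec N) : natvec N :=
  produce_word q (word_of n).

Definition locally_irreducible V E (N : @abelian_network V E) : Prop :=
  forall q q' : state N, exists w w', act_word q w = act_word q' w'.

Definition end_id (T : finType) : {ffun T -> T} := [ffun x => x].

Definition end_comp (T : finType) (f g : {ffun T -> T}) : {ffun T -> T} :=
  [ffun x => f (g x)].

Definition letter_end V E (N : @abelian_network V E) (a : letter N) :
    {ffun state N -> state N} :=
  [ffun q => act q a].

(* The submonoid of End(Q) generated by the [letter_end a], as the set of maps
   reachable from the identity by composing with generators; see
   [transition_monoidP]. *)
Definition transition_monoid V E (N : @abelian_network V E) :
    {set {ffun state N -> state N}} :=
  [set f | connect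
     (fun g h => [exists a : letter N, h == end_comp (letter_end a) g])
     (end_id (state N)) f].

Definition idempotent_product V E (N : @abelian_network V E) :
    {ffun state N -> state N} :=
  \big[@end_comp (state N)/end_id (state N)]_(f in transition_monoid N
    | end_comp f f == f) f.

Definition locally_recurrent V E (N : @abelian_network V E) :
    {set state N} :=
  [set idempotent_product N q | q : state N].

Definition pos_part V E (N : @abelian_network V E) (z : intvec N) : natvec N :=
  [ffun a => `|Num.max (z a) 0|%N].

Definition neg_part V E (N : @abelian_network V E) (z : intvec N) : natvec N :=
  [ffun a => `|Num.max (- z a) 0|%N].

Definition total_kernel V E (N : @abelian_network V E) (z : intvec N) : Prop :=
  forall q, q \in locally_recurrent N ->
    act_vec q (pos_part z) = act_vec q (neg_part z).

(* Matrices indexed by the letters are square matrices of size [#|letter N|],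
   with the letter [a] at index [enum_rank a]. *)
Definition letter_mx V E (N : @abelian_network V E) : Type :=
  'M[rat]_#|letter N|.

Definition col_of V E (N : @abelian_network V E) (z : intvec N) :
    'cV[rat]_#|letter N| :=
  \col_i (z (enum_val i))%:~R.

Definition is_production_matrix V E (N : @abelian_network V E)
    (P : letter_mx N) : Prop :=
  forall (k : natvec N) (q : state N),
    total_kernel (intvec_of k) -> q \in locally_recurrent N ->
    P *m col_of (intvec_of k) = col_of (intvec_of (produce_vec q k)).

Definition is_spectral_radius n (M : 'M[algC]_n) (rho : algC) : Prop :=
  (exists2 z, eigenvalue M z & `|z| = rho) /\
  (forall z, eigenvalue M z -> `|z| <= rho).

(* The complex eigenvalues of a rational matrix are algebraic numbers. *)
Definition critical V E (N : @abelian_network V E) (P : letter_mx N) : Prop :=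
  is_spectral_radius (map_mx ratr P : 'M[algC]_#|letter N|) 1.

Definition strongly_connected V E (N : @abelian_network V E)
    (P : letter_mx N) : Prop :=
  forall a b : letter N,
    connect (fun a b => 0 < P (enum_rank b) (enum_rank a)) a b.

Definition is_period_vector V E (N : @abelian_network V E)
    (P : letter_mx N) (r : natvec N) : Prop :=
  (forall a, (0 < r a)%N) /\
  (forall k : intvec N,
     (total_kernel k /\ P *m col_of k = col_of k) <->
     (exists m : int, k = intvec_of r *~ m)).

Definition legally_related V E (N : @abelian_network V E)
    (c1 c2 : config N) : Prop :=
  exists2 c3, reaches c1 c3 & reaches c2 c3.

Definition recurrent V E (N : @abelian_network V E) (c : config N) : Prop :=
  (exists2 w, w != [::] & legal c w) /\
  (forall c', legally_related c' c -> reaches c' c).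

Definition maximal_execution V E (N : @abelian_network V E) (r : natvec N)
    (c : config N) (w : seq (letter N)) : Prop :=
  [/\ legal c w,
      forall a, (wcount w a <= r a)%N
    & forall a, wcount w a = r a \/ ~~ legal c (rcons w a)].

Lemma wcount_word_of V E (N : @abelian_network V E) (n : natvec N) :
  wcount (word_of n) = n.
Proof.
apply/ffunP=> a; rewrite ffunE /word_of count_flatten -map_comp sumnE big_map.
rewrite big_enum /= (bigD1 a) //= big1 ?addn0 ?count_nseq /= ?eqxx ?mul1n //.
by move=> b ba; rewrite count_nseq /= (negPf ba).
Qed.

Lemma actC V E (N : @abelian_network V E) (q : state N) (a b : letter N) :
  act (act q a) b = act (act q b) a.
Proof.
case: a b => [v a] [u b]; apply/ffunP=> x; rewrite /act !ffunE /=.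
have [uv|uv] := eqVneq u v.
  case: v / uv a => a; have [ux|ux] := eqVneq u x.
    by case: x / ux; rewrite !dfwith_in transitionC.
  by rewrite !dfwith_out // !ffunE !dfwith_out.
have [ux|ux] := eqVneq u x.
  case: x / ux; rewrite dfwith_in dfwith_out 1?eq_sym //.
  by rewrite dfwith_out 1?eq_sym // ffunE dfwith_in.
rewrite dfwith_out // ffunE.
have [vx|vx] := eqVneq v x.
  by case: x / vx ux => ux; rewrite !dfwith_in dfwith_out.
by rewrite !dfwith_out // ffunE dfwith_out.
Qed.

Lemma produceC V E (N : @abelian_network V E) (q : state N) (a b x : letter N) :
  (produce q a x + produce (act q a) b x =
   produce q b x + produce (act q b) a x)%N.
Proof.
case: a b => [v a] [u b]; rewrite !ffunE /=.
have [uv|uv] := eqVneq u v; last first.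
  by rewrite !dfwith_out ?[v == u]eq_sym // addnC.
case: v / uv a => a; rewrite !dfwith_in -!big_split /=.
apply: eq_bigr => y _; rewrite -!big_split /=; apply: eq_bigr => e _.
rewrite !ffunE -!count_cat -!map_cat; apply/permP/perm_map/messageC.
Qed.

Lemma wcount_perm V E (N : @abelian_network V E) (w w' : seq (letter N)) :
  wcount w = wcount w' -> perm_eq w w'.
Proof.
move/ffunP=> ww'; apply/allP=> a _ /=; have := ww' a; rewrite !ffunE => ->.
by rewrite eqxx.
Qed.

Lemma act_word_perm V E (N : @abelian_network V E) (q : state N)
    (w w' : seq (letter N)) :
  wcount w = wcount w' -> act_word q w = act_word q w'.
Proof.
move/wcount_perm; elim: w q w' => [|a w IHw] q w'.
  by move/perm_size/esym/size0nil->.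
move=> eqw; have := perm_mem eqw a; rewrite mem_head => /esym aw'.
case/splitPr: aw' eqw => s1 s2.
rewrite perm_sym -cat1s perm_catCA /= perm_cons perm_sym => /IHw /= ->.
rewrite /act_word !foldl_cat /=; congr foldl.
by elim: s1 q => //= b s1 IHs q; rewrite actC IHs.
Qed.

Lemma produce_word_cons V E (N : @abelian_network V E) (q : state N)
    (a : letter N) (w : seq (letter N)) x :
  (produce_word q (a :: w) x = produce q a x + produce_word (act q a) w x)%N.
Proof. by rewrite [LHS]ffunE. Qed.

Lemma produce_word_perm V E (N : @abelian_network V E) (q : state N)
    (w w' : seq (letter N)) :
  wcount w = wcount w' -> produce_word q w = produce_word q w'.
Proof.
move/wcount_perm; elim: w q w' => [|a w IHw] q w'.
  by move/perm_size/esym/size0nil->.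
move=> eqw; have := perm_mem eqw a; rewrite mem_head => /esym aw'.
case/splitPr: aw' eqw => s1 s2.
rewrite perm_sym -cat1s perm_catCA /= perm_cons perm_sym => eqw.
apply/ffunP=> x; rewrite produce_word_cons (IHw _ _ eqw).
elim: s1 q {eqw} => [|b s1 IHs] q; first by rewrite produce_word_cons.
by rewrite !cat_cons !produce_word_cons -IHs addnA produceC -addnA actC.
Qed.

Lemma transition_monoidP V E (N : @abelian_network V E)
    (f : {ffun state N -> state N}) :
  reflect (exists w, f = [ffun q => act_word q w]) (f \in transition_monoid N).
Proof.
rewrite inE; apply: (iffP connectP) => [[p + ->]|[w ->]].
  elim/last_ind: p => [|p g IHp]; first by exists [::]; apply/ffunP=> q; rewrite !ffunE.
  rewrite rcons_path last_rcons => /andP[/IHp[w ->] /existsP[a /eqP->]].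
  by exists (rcons w a); apply/ffunP=> q; rewrite !ffunE /act_word foldl_rcons.
elim/last_ind: w => [|w a [p ep fp]].
  by exists [::] => //; apply/ffunP=> q; rewrite !ffunE.
exists (rcons p [ffun q => act_word q (rcons w a)]); last by rewrite last_rcons.
rewrite rcons_path ep -fp; apply/existsP; exists a; apply/eqP/ffunP=> q.
by rewrite !ffunE /act_word foldl_rcons.
Qed.

(* Main.v *)
(** A legal loop at [x.q], with letter counts [n], satisfies [P n = n]; since
    [P >= 0] is strongly connected, [n] has full support, hence [q] is locally
    recurrent and [n >= r].  A recurrent configuration lies on such a loop.  If
    an [r]-maximal [w] had [s = r - |w|] nonzero, then the letter that opens the
    shortest suffix of the loop with counts at least [s] could still be fired
    after [w].  Conversely, if [|w| = r] and [w] fixes [q], then [w] is a legal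
    loop, and after any legal excursion [u] the exchange lemma completes [u] to
    a power of [w], which leads back to [x.q]. *)
Require Import Defs.
From mathcomp Require Import all_boot all_order all_algebra all_field.
From mathcomp Require Import zify ring.
Set Implicit Arguments.
Unset Strict Implicit.
Unset Printing Implicit Defensive.
Import Order.TTheory GRing.Theory Num.Theory.
Local Open Scope ring_scope.

(** * Firing words and letter counts *)

Section Words.

Variables (V : finType) (E : V -> V -> finType) (N : abelian_network E).
Implicit Types (q : state N) (x : intvec N) (c : config N).
Implicit Types (u v w : seq (letter N)) (a b : letter N).

Lemma wcountE w a : wcount w a = count_mem a w.
Proof. by rewrite ffunE. Qed.

Lemma wcount_cat u v a : wcount (u ++ v) a = (wcount u a + wcount v a)%N.
Proof. by rewrite !ffunE count_cat. Qed.

Lemma wcount_cons b w a : wcount (b :: w) a = ((b == a) + wcount w a)%N.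
Proof. by rewrite !ffunE. Qed.

Lemma wcount_catC u v : wcount (u ++ v) = wcount (v ++ u).
Proof. by apply/ffunP=> a; rewrite !wcount_cat addnC. Qed.

Lemma wcount_rcons a w : wcount (a :: w) = wcount (rcons w a).
Proof. by rewrite -cats1 wcount_catC. Qed.

Lemma wcount_flatten_nseq k w a :
  wcount (flatten (nseq k w)) a = (k * wcount w a)%N.
Proof.
by elim: k => [|k IHk]; [rewrite ffunE | rewrite wcount_cat IHk mulSn].
Qed.

Lemma act_word_cat q u v : act_word q (u ++ v) = act_word (act_word q u) v.
Proof. exact: foldl_cat. Qed.

Lemma act_word_catC q u v :
  act_word (act_word q u) v = act_word (act_word q v) u.
Proof. by rewrite -!act_word_cat; apply/act_word_perm/wcount_catC. Qed.

Lemma produce_word_cat q u v b : produce_word q (u ++ v) b =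
  (produce_word q u b + produce_word (act_word q u) v b)%N.
Proof.
elim: u q => [|a u IHu] q /=; first by rewrite ffunE.
by rewrite !ffunE IHu addnA.
Qed.

Lemma fire_wordE c w : fire_word c w =
  ([ffun b => c.1 b + (produce_word c.2 w b)%:Z - (wcount w b)%:Z],
   act_word c.2 w).
Proof.
elim: w c => [|a w IHw] [x q] /=.
  by congr pair; apply/ffunP=> b; rewrite !ffunE /= addr0 subr0.
rewrite IHw /=; congr pair; apply/ffunP=> b; rewrite !ffunE /= [b == a]eq_sym.
by rewrite !PoszD; ring.
Qed.

Lemma fire_word_cat c u v : fire_word c (u ++ v) = fire_word (fire_word c u) v.
Proof. exact: foldl_cat. Qed.

Lemma fire_word_cons c a w : fire_word c (a :: w) = fire_word (fire c a) w.
Proof. by []. Qed.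

Lemma fire_word_rcons c w a : fire_word c (rcons w a) = fire (fire_word c w) a.
Proof. exact: foldl_rcons. Qed.

Lemma fire_word_perm c u v : wcount u = wcount v -> fire_word c u = fire_word c v.
Proof.
move=> uv.
by rewrite !fire_wordE (act_word_perm _ uv) (produce_word_perm _ uv) uv.
Qed.

Lemma act_vec_wcount q w : act_vec q (wcount w) = act_word q w.
Proof. exact/act_word_perm/wcount_word_of. Qed.

Lemma produce_vec_wcount q w : produce_vec q (wcount w) = produce_word q w.
Proof. exact/produce_word_perm/wcount_word_of. Qed.

(** * Legal executions, exchange and loops *)

Lemma legal_cat c u v : legal c (u ++ v) = legal c u && legal (fire_word c u) v.
Proof. by elim: u c => //= a u IHu c; rewrite IHu andbA. Qed.

Lemma legal_rcons c w a :
  legal c (rcons w a) = legal c w && (1 <= (fire_word c w).1 a).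
Proof. by rewrite -cats1 legal_cat /= andbT. Qed.

(* By commutativity [u] produces at least as much after [a] as before it, so
   firing [a] first only costs chips at [a] itself. *)
Lemma legal_fire c a u : legal c u -> a \notin u -> legal (fire c a) u.
Proof.
elim/last_ind: u => // u b IHu; rewrite !legal_rcons mem_rcons inE negb_or.
move=> /andP[/IHu legal_u xb] /andP[ab /legal_u->] /=.
rewrite -fire_word_cons (fire_word_perm _ (wcount_rcons _ _)) fire_word_rcons.
rewrite !ffunE [b == a]eq_sym (negPf ab) subr0.
by apply: (le_trans xb); rewrite lerDl.
Qed.

(** The first occurrence of [a] in [w], if any, is moved to the front. The letters before it stay
    legal by [legal_fire], and those after it see the same configuration as before. *)
Lemma exchange_letter c a w : legal c w -> 1 <= c.1 a ->
  exists2 w', legal (fire c a) w' &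
    forall b, wcount w' b = (wcount w b - (a == b))%N.
Proof.
move=> legal_w ca; have [aw|aw] := boolP (a \in w); last first.
  exists w; first exact: legal_fire.
  move=> b; have [<-|] := eqVneq a b; last by rewrite subn0.
  by rewrite wcountE (count_memPn aw).
pose i := index a w.
have defw : w = take i w ++ a :: drop i.+1 w.
  by rewrite -{1}(cat_take_drop i w) (drop_nth a) ?index_mem ?nth_index.
have a_notin : a \notin take i w.
  by apply/negP=> /index_ltn; rewrite ltnn.
move: (take i w) (drop i.+1 w) a_notin defw legal_w => u v au -> {aw i w}.
rewrite legal_cat => /andP[legal_u legal_av].
exists (u ++ v).
  rewrite legal_cat legal_fire //=.
  move: legal_av => /= /andP[_].
  by rewrite -fire_word_rcons -(fire_word_perm _ (wcount_rcons _ _)).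
by move=> b; rewrite !wcount_cat wcount_cons addnCA addKn.
Qed.

Lemma exchange c u w : legal c u -> legal c w ->
  exists2 w', legal (fire_word c u) w' &
    forall b, wcount w' b = (wcount w b - wcount u b)%N.
Proof.
elim: u c w => [|a u IHu] c w /=.
  by move=> _ legal_w; exists w => // b; rewrite [wcount [::] b]wcountE subn0.
move=> /andP[ca legal_u] /exchange_letter/(_ ca)[w1 legal_w1 w1E].
have [w' legal_w' w'E] := IHu _ _ legal_u legal_w1.
by exists w' => // b; rewrite w'E w1E wcount_cons subnDA.
Qed.

Lemma legal_loop c w k : legal c w -> fire_word c w = c ->
  legal c (flatten (nseq k w)) /\ fire_word c (flatten (nseq k w)) = c.
Proof.
move=> legal_w loop; elim: k => [|k [IHl IHf]] //=.
by rewrite legal_cat fire_word_cat loop legal_w IHl IHf.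
Qed.

(** As every letter occurs in [w], the power of [w] with exponent [size u] has counts at least those
    of [u]. Exchange then completes [u] legally to a permutation of this power, which returns to
    [c]. *)
Lemma recurrent_loop c w : legal c w -> fire_word c w = c ->
  w != [::] -> (forall a, a \in w) -> recurrent c.
Proof.
move=> legal_w loop w_neq0 w_full; split; first by exists w.
move=> c' [c3 [u' legal_u' def_c3] [u legal_u eq_c3]].
have [legal_wk loopk] := legal_loop (size u) legal_w loop.
have [v legal_v vE] := exchange legal_u legal_wk.
exists (u' ++ v); first by rewrite legal_cat legal_u' def_c3 -eq_c3.
rewrite fire_word_cat def_c3 -eq_c3 -fire_word_cat -[RHS]loopk.
apply/fire_word_perm/ffunP=> a; rewrite wcount_cat vE subnKC //.
rewrite wcount_flatten_nseq !wcountE (leq_trans (count_size _ _)) //.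
by rewrite leq_pmulr // -has_count has_pred1.
Qed.

(** A configuration reached from [c] is legally related to [c], so recurrence supplies the way
    back. *)
Lemma recurrent_has_loop c : recurrent c ->
  exists w, [/\ w != [::], legal c w & fire_word c w = c].
Proof.
case=> [[u u_neq0 legal_u] c_rec].
have [|v legal_v loop] := c_rec (fire_word c u).
  by exists (fire_word c u); [exists [::] | exists u].
exists (u ++ v); split; first by case: u u_neq0 {legal_u loop legal_v}.
  by rewrite legal_cat legal_u.
by rewrite fire_word_cat.
Qed.

(** The suffix [a :: y] is the shortest one with counts at least [s], so dropping its head makes the
    count of [a] fall short by exactly one. *)
Lemma shortest_suffix (s : natvec N) w :
    (exists a, 0 < s a)%N -> (forall a, s a <= wcount w a)%N ->
  exists p a y, [/\ w = p ++ a :: y, s a = (wcount y a).+1 &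
    forall b, (s b <= wcount (a :: y) b)%N].
Proof.
move=> [a0 sa0]; elim: w => [|b y IHy] le_s.
  by have := le_s a0; rewrite ffunE leqn0 eqn0Ngt sa0.
have [/forallP /IHy[p [a [y' [-> ? ?]]]]|/forallPn[a]] :=
  boolP [forall a, s a <= wcount y a]%N.
  by exists (b :: p), a, y'.
rewrite -ltnNge => lt_s; have := le_s a; rewrite wcount_cons.
have [ba|_] := eqVneq b a; last by rewrite add0n leqNgt lt_s.
by rewrite add1n => ge_s; exists [::], b, y; split=> //; rewrite ba; lia.
Qed.

(** * Periods of words and local recurrence *)

Lemma act_word_flatten_nseq q k w : act_word q w = q ->
  act_word q (flatten (nseq k w)) = q.
Proof. by move=> qw; elim: k => //= k IHk; rewrite act_word_cat qw. Qed.

Lemma produce_word_flatten_nseq q k w b : act_word q w = q ->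
  produce_word q (flatten (nseq k w)) b = (k * produce_word q w b)%N.
Proof.
move=> qw; elim: k => [|k IHk] /=; first by rewrite ffunE.
by rewrite produce_word_cat qw IHk mulSn.
Qed.

Lemma act_word_idempotent_power w : exists2 k, (0 < k)%N &
  forall q, act_word (act_word q (flatten (nseq k w))) (flatten (nseq k w)) =
    act_word q (flatten (nseq k w)).
Proof.
pose f q := act_word q w.
have powE k q : act_word q (flatten (nseq k w)) = iter k f q.
  elim: k q => //= k IHk q.
  by rewrite act_word_cat act_word_catC IHk.
pose g (i : 'I_#|{ffun state N -> state N}|.+1) : {ffun state N -> state N} :=
  [ffun q => iter i f q].
(* Pigeonhole: there is one more iterate than there are self-maps of the state space. *)
have /injectivePn[i [j ij gij]] : ~~ injectiveb g.
  by apply/injectiveP=> /leq_card; rewrite card_ord ltnn.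
wlog lt_ij : i j ij gij / (i < j)%N.
  move=> Hw; have [|ji|/val_inj e] := ltngtP i j; first exact: Hw gij.
    by apply: (Hw j i) => //; rewrite eq_sym.
  by rewrite e eqxx in ij.
have per m q : (i <= m)%N -> iter (m + (j - i)) f q = iter m f q.
  move=> im; have -> : (m + (j - i) = (m - i) + j)%N by lia.
  rewrite iterD; have := congr1 (fun h : {ffun state N -> state N} => h q) gij.
  rewrite /= !ffunE => <-.
  by rewrite -iterD subnK.
(* A multiple of the period [j - i] that is at least the preperiod [i], so doubling it does not
   change the iterate. *)
exists ((j - i) * i.+1)%N => [|q]; first by rewrite muln_gt0 subn_gt0 lt_ij.
rewrite !powE -iterD; set k := (_ * _)%N.
have ik : (i <= k)%N by rewrite /k; nia.
have : forall l, iter (k + (j - i) * l) f q = iter k f q.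
  elim=> [|l IHl]; first by rewrite muln0 addn0.
  by rewrite mulnS [(_ - _ + _)%N]addnC addnA per ?IHl //; lia.
exact.
Qed.

Lemma idempotent_product_act : exists w,
  forall q, idempotent_product N q = act_word q w.
Proof.
have [w eE] : exists w, idempotent_product N = [ffun q => act_word q w].
  rewrite /idempotent_product.
  apply: (big_ind (fun f => exists w, f = [ffun q => act_word q w])).
  - by exists [::]; apply/ffunP=> q; rewrite !ffunE.
  - move=> _ _ [u ->] [v ->]; exists (v ++ u).
    by apply/ffunP=> q; rewrite !ffunE act_word_cat.
  - by move=> f /andP[/transition_monoidP].
by exists w => q; rewrite eE ffunE.
Qed.

Lemma act_word_locally_recurrent q w :
  q \in locally_recurrent N -> act_word q w \in locally_recurrent N.
Proof.
have [e eE] := idempotent_product_act.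
case/imsetP=> q' _ ->; apply/imsetP; exists (act_word q' w) => //.
by rewrite !eE act_word_catC.
Qed.

Lemma locally_recurrent_word :
  exists w, forall q, act_word q w \in locally_recurrent N.
Proof.
have [e eE] := idempotent_product_act; exists e => q.
by rewrite -eE; apply: imset_f.
Qed.

(** The action of [w] is one of the factors of the idempotent product. It commutes past the other
    factors and is absorbed by its own copy. *)
Lemma locally_recurrent_idempotent q w :
    (forall q', act_word (act_word q' w) w = act_word q' w) ->
  q \in locally_recurrent N -> act_word q w = q.
Proof.
move=> ww; case/imsetP=> q' _ {q}->.
pose f : {ffun state N -> state N} := [ffun q => act_word q w].
have f_mon : f \in transition_monoid N by apply/transition_monoidP; exists w.
have ff : end_comp f f == f.
  by apply/eqP/ffunP=> q; rewrite !ffunE ww.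
have f_in : f \in index_enum {ffun state N -> state N} by rewrite mem_index_enum.
rewrite /idempotent_product.
elim: (index_enum _) f_in => // g s IHs; rewrite inE big_cons => /predU1P[<-|fs].
  by rewrite f_mon ff /= !ffunE ww.
case: ifP => [/andP[/transition_monoidP[v ->] _]|_]; last exact: IHs.
by rewrite !ffunE act_word_catC IHs.
Qed.

Lemma locally_recurrent_period w : exists2 k, (0 < k)%N &
  forall q, q \in locally_recurrent N -> act_word q (flatten (nseq k w)) = q.
Proof.
have [k k_gt0 wk] := act_word_idempotent_power w.
by exists k => // q; apply: locally_recurrent_idempotent.
Qed.

(** A positive power of [w] acts as the identity on the locally recurrent states. *)
Lemma act_word_inj w :
  {in locally_recurrent N &, injective (fun q => act_word q w)}.
Proof.
have [[//|k] _ wk] := locally_recurrent_period w.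
move=> q q' Lq Lq' /= eq_w.
by rewrite -(wk q) // -(wk q') //= !act_word_cat eq_w.
Qed.

(** A large power of [w] contains all letters of a word [e] that sends every state to a locally
    recurrent one. Reordered so that [e] comes last, this power still fixes [q]. *)
Lemma full_fixed_locally_recurrent q w :
  (forall a, a \in w) -> act_word q w = q -> q \in locally_recurrent N.
Proof.
move=> w_full qw; have [e Le] := locally_recurrent_word.
pose v := word_of [ffun a => wcount (flatten (nseq (size e) w)) a - wcount e a]%N.
rewrite -(act_word_flatten_nseq (size e) qw).
rewrite (@act_word_perm _ _ _ _ _ (v ++ e)) ?act_word_cat //.
apply/ffunP=> a; rewrite wcount_cat wcount_word_of ffunE subnK //.
rewrite wcount_flatten_nseq !wcountE (leq_trans (count_size _ _)) //.
by rewrite leq_pmulr // -has_count has_pred1.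
Qed.

(** Irreducibility leads [q] and [q'] to a common state, which [w] fixes because it fixes [q].
    Injectivity of [u'] pulls this back to [q']. *)
Lemma fixed_locally_recurrent q q' w : locally_irreducible N ->
    q \in locally_recurrent N -> q' \in locally_recurrent N ->
  act_word q w = q -> act_word q' w = q'.
Proof.
move=> irrN Lq Lq' qw; have [u [u' uu']] := irrN q q'.
apply: (@act_word_inj u') => //=; first exact: act_word_locally_recurrent.
by rewrite act_word_catC -uu' act_word_catC qw.
Qed.

Lemma total_kernel_wcount w : total_kernel (intvec_of (wcount w)) <->
  (forall q, q \in locally_recurrent N -> act_word q w = q).
Proof.
have posE : pos_part (intvec_of (wcount w)) = wcount w.
  by apply/ffunP=> a; rewrite !ffunE; lia.
have negE : neg_part (intvec_of (wcount w)) = wcount [::].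
  by apply/ffunP=> a; rewrite !ffunE /=; lia.
by split=> H q /H; rewrite posE negE !act_vec_wcount.
Qed.

End Words.

(** * The production matrix and loops *)

Section Production.

Variables (V : finType) (E : V -> V -> finType) (N : abelian_network E).
Variable P : letter_mx N.
Hypothesis P_production : is_production_matrix P.
Implicit Types (q : state N) (u v w : seq (letter N)) (a b : letter N).

Lemma col_of_natvec (n : natvec N) a j :
  col_of (intvec_of n) (enum_rank a) j = (n a)%:R.
Proof. by rewrite mxE ffunE enum_rankK. Qed.

Lemma mulmx_col_of (n : natvec N) b j :
  (P *m col_of (intvec_of n)) (enum_rank b) j =
  \sum_a P (enum_rank b) (enum_rank a) * (n a)%:R.
Proof.
rewrite mxE (reindex (@enum_rank (letter N))) /=; last first.
  by exists enum_val => ? _; rewrite ?enum_valK ?enum_rankK.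
by apply: eq_bigr => a _; rewrite col_of_natvec.
Qed.

Lemma production_word q w :
    (forall q', q' \in locally_recurrent N -> act_word q' w = q') ->
    q \in locally_recurrent N ->
  forall b, \sum_a P (enum_rank b) (enum_rank a) * (wcount w a)%:R =
    (produce_word q w b)%:R.
Proof.
move=> /total_kernel_wcount Kw Lq b.
have /matrixP/(_ (enum_rank b) 0) := P_production Kw Lq.
by rewrite mulmx_col_of col_of_natvec produce_vec_wcount.
Qed.

(** Some power of the one-letter word [a] lies in the total kernel, and its production is a positive
    multiple of column [a] of [P]. *)
Lemma production_ge0 (q0 : state N) a b :
  0 <= P (enum_rank b) (enum_rank a).
Proof.
have [e Le] := locally_recurrent_word N.
have [k k_gt0 Kk] := locally_recurrent_period [:: a].
have := production_word Kk (Le q0) b.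
rewrite (bigD1 a) //= big1 => [|c ca].
  rewrite addr0 wcount_flatten_nseq wcountE /= eqxx muln1 => Pk.
  have : 0 <= P (enum_rank b) (enum_rank a) * k%:R by rewrite Pk ler0n.
  by rewrite pmulr_lge0 // ltr0n.
by rewrite wcount_flatten_nseq wcountE /= eq_sym (negPf ca) muln0 mulr0.
Qed.

(* The state [q] need not be locally recurrent: a word [e] moving it to a
   locally recurrent state produces the same before and after the loop. *)
Lemma production_loop q w :
    act_word q w = q -> produce_word q w = wcount w ->
  forall b, \sum_a P (enum_rank b) (enum_rank a) * (wcount w a)%:R =
    (wcount w b)%:R.
Proof.
move=> qw prod_w b; have [e Le] := locally_recurrent_word N.
have [k k_gt0 Kk] := locally_recurrent_period w.
have := production_word Kk (Le q) b.
have -> : produce_word (act_word q e) (flatten (nseq k w)) b = (k * wcount w b)%N.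
  apply/(@addnI (produce_word q e b)); rewrite -produce_word_cat.
  rewrite (produce_word_perm _ (wcount_catC _ _)) produce_word_cat.
  by rewrite produce_word_flatten_nseq // act_word_flatten_nseq // prod_w addnC.
under eq_bigr do rewrite wcount_flatten_nseq natrM mulrCA.
rewrite -mulr_sumr natrM; apply: mulfI.
by rewrite pnatr_eq0 -lt0n.
Qed.

(** The counts of [w] are a nonnegative fixed vector of [P], so their support is closed under the
    edges of the letter digraph. *)
Lemma loop_full q w : strongly_connected P -> w != [::] ->
    act_word q w = q -> produce_word q w = wcount w ->
  forall a, a \in w.
Proof.
move=> Psc w_neq0 qw prod_w b; have Pw := production_loop qw prod_w.
have [a aw] : exists a, a \in w.
  by case: w w_neq0 {qw prod_w Pw} => // a w; exists a; rewrite mem_head.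
have /connectP[p + ->] := Psc a b.
elim: p a aw => //= c p IHp a aw /andP[Pac]; apply: IHp.
have : 0 < (wcount w c)%:R :> rat.
  rewrite -Pw (bigD1 a) //= ltr_wpDr ?sumr_ge0 // => [d _|].
    by rewrite mulr_ge0 ?ler0n ?(production_ge0 q).
  by rewrite mulr_gt0 // ltr0n wcountE -has_count has_pred1.
by rewrite ltr0n wcountE -has_count has_pred1.
Qed.

(** The counts of the loop are fixed by [P] and lie in the total kernel, so they are an integer
    multiple of [r]; positivity forces the factor to be at least 1. *)
Lemma period_vector_le (r : natvec N) q w : locally_irreducible N ->
    strongly_connected P -> is_period_vector P r -> w != [::] ->
    act_word q w = q -> produce_word q w = wcount w ->
  forall a, (r a <= wcount w a)%N.
Proof.
move=> irrN Psc [r_gt0 rP] w_neq0 qw prod_w a.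
have w_full := loop_full Psc w_neq0 qw prod_w.
have Lq := full_fixed_locally_recurrent w_full qw.
have [] := rP (intvec_of (wcount w)).
case=> [|m /ffunP/(_ a) + _].
  split; first by apply/total_kernel_wcount=> q' Lq'; apply: fixed_locally_recurrent qw.
  apply/matrixP=> i j; rewrite -[i]enum_valK mulmx_col_of col_of_natvec.
  exact: production_loop qw prod_w _.
rewrite ffunMzE mulrzz !ffunE => eq_m.
have : (0 < count_mem a w)%N by rewrite -has_count has_pred1.
move: (count_mem a w) (r a) eq_m (r_gt0 a) => n k nk k_gt0 n_gt0.
have m_gt0 : 0 < m by rewrite -(@pmulr_rgt0 _ k%:Z) // -nk.
by rewrite -lez_nat nk ler_peMr.
Qed.

Lemma period_vector_fixed (r : natvec N) q w : is_period_vector P r ->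
  q \in locally_recurrent N -> wcount w = r ->
  act_word q w = q /\ produce_word q w = r.
Proof.
move=> [_ rP] Lq wr; have [_ []] := rP (intvec_of r); first by exists 1.
rewrite -wr => Kw PwE; split; first by move/total_kernel_wcount: Kw; exact.
have := P_production Kw Lq; rewrite PwE => /matrixP eq_col.
apply/ffunP=> a; have := eq_col (enum_rank a) 0.
by rewrite produce_vec_wcount !col_of_natvec => /eqP; rewrite eqr_nat => /eqP.
Qed.

End Production.

Theorem theorem5p6 (V : finType) (E : V -> V -> finType)
    (N : abelian_network E) (P : letter_mx N) (r : natvec N)
    (N_loc_irr : locally_irreducible N)
    (P_production : is_production_matrix P)
    (N_strongly_connected : strongly_connected P)
    (N_critical : critical P)
    (r_period : is_period_vector P r)
    (x : intvec N) (q : state N) (w : seq (letter N))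
    (w_maximal : maximal_execution r (x, q) w) :
  recurrent (x, q) <-> (wcount w = r /\ act_word q w = q).
Proof.
case: w_maximal => legal_w le_wr max_w; split; last first.
  move=> [wr qw].
  have w_full a : a \in w.
    by rewrite -has_pred1 has_count -wcountE wr; case: r_period.
  have Lq := full_fixed_locally_recurrent w_full qw.
  have [_ prod_w] := period_vector_fixed P_production r_period Lq wr.
  apply: (recurrent_loop legal_w) => //.
    rewrite fire_wordE /= qw prod_w wr; congr pair.
    by apply/ffunP=> b; rewrite !ffunE addrK.
  (* An eigenvector has a nonzero coordinate, so a letter exists and [w], which contains all
     letters, is nonempty. *)
  have [[z /eigenvalueP[v _ /rV0Pn[i _]] _] _] := N_critical.
  by apply/eqP=> w0; have := w_full (enum_val i); rewrite w0.
move=> /recurrent_has_loop[w' [w'_neq0 legal_w' loop]].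
move: (loop); rewrite fire_wordE => -[/ffunP prod_w' qw'].
have {}prod_w' : produce_word q w' = wcount w'.
  by apply/ffunP=> b; have := prod_w' b; rewrite ffunE /=; lia.
have w'_full := loop_full P_production N_strongly_connected w'_neq0 qw' prod_w'.
have Lq := full_fixed_locally_recurrent w'_full qw'.
have le_rw' := period_vector_le P_production N_loc_irr N_strongly_connected
  r_period w'_neq0 qw' prod_w'.
suff wr : wcount w = r.
  by split=> //; have [] := period_vector_fixed P_production r_period Lq wr.
pose s : natvec N := [ffun a => r a - wcount w a]%N.
apply/eqP/negPn/negP=> /eqP neq_wr.
have /existsP s_neq0 : [exists a, 0 < s a]%N.
  apply: contra_notT neq_wr; rewrite negb_exists => /forallP s0.
  apply/ffunP=> a; apply/eqP; rewrite eqn_leq le_wr -subn_eq0.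
  by have := s0 a; rewrite ffunE -eqn0Ngt.
have [a|p [a [y [def_w' sa le_s]]]] := @shortest_suffix _ _ _ s w' s_neq0.
  by rewrite ffunE; apply: leq_trans (le_rw' a); apply: leq_subr.
(* The occurrence of [a] at the head of this suffix is the least recent
   among the last [s b] firings of each letter [b]; since then [a] has
   received everything that [s] produces, enough to make it legal after
   [w]. *)
pose t := word_of [ffun b => wcount (a :: y) b - s b]%N.
have ay_ts : wcount (a :: y) = wcount (t ++ word_of s).
  by apply/ffunP=> b; rewrite wcount_cat !wcount_word_of ffunE subnK.
have ws_r : wcount (w ++ word_of s) = r.
  by apply/ffunP=> b; rewrite wcount_cat wcount_word_of [s b]ffunE subnKC.
have [q_ws prod_ws] := period_vector_fixed P_production r_period Lq ws_r.
(* Followed by [s], both words return to [q]: the first becomes a permutation of [w'], the second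
   has counts [r]. Injectivity of [s] on locally recurrent states cancels it. *)
have eq_q1 : act_word q (p ++ t) = act_word q w.
  apply: (@act_word_inj _ _ _ (word_of s)); rewrite ?act_word_locally_recurrent //=.
  rewrite -!act_word_cat q_ws -catA act_word_cat -(act_word_perm _ ay_ts).
  by rewrite -act_word_cat -def_w'.
have := legal_w'; rewrite def_w' legal_cat => /andP[_ /= /andP[xpa _]].
have [wa|] := max_w a; first by move: sa; rewrite ffunE wa subnn.
move/negP; apply; rewrite legal_rcons legal_w /=.
move: xpa; rewrite !fire_wordE /= !ffunE -!wcountE => xpa.
have := congr1 (fun f : natvec N => f a) prod_ws.
rewrite /= produce_word_cat => prod_a.
have := congr1 (fun f : natvec N => f a) prod_w'.
rewrite /= def_w' produce_word_cat (produce_word_perm _ ay_ts) produce_word_cat.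
rewrite -act_word_cat eq_q1 wcount_cat wcount_cons eqxx => prod_w'a.
(* Eliminating the production of [s] from the two balances, the number of chips at [a] after [w]
   equals that after [p] plus the production of [t] at [a], hence is at least 1. *)
move: sa (le_wr a); rewrite ffunE.
move: (wcount w a) (wcount p a) (wcount y a) (r a) (produce_word q w a)
  (produce_word q p a) (produce_word (act_word q p) t a)
  (produce_word (act_word q w) (word_of s) a) xpa prod_a prod_w'a => *; lia.
Qed.
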